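(* For all $k_1,k_2\geq 1$ and $r\geq 1$ there exist colored graphs $G$ and $H$ such that Spoiler has a winning strategy for $\operatorname{BP}_{(k_1,k_2)}(G,H)$, and in every winning strategy Spoiler must (re)use every reusable pebble pair at least $r$ times (at least once if $k_1=1$) before using a new non-reusable pebble pair.
   Context: Let $[x_{k_1}]=\{x_1,\dots,x_{k_1}\}$ (reusable pebble pairs), $[y_{k_2}]=\{y_1,\dots,y_{k_2}\}$ (non-reusable pebble pairs). A $(k_1,k_2)$-configuration on colored graphs $G,H$ is a pair of partial functions $\alpha\colon[x_{k_1}]\cup[y_{k_2}]\rightharpoonup V(G)$, $\beta\colon[x_{k_1}]\cup[y_{k_2}]\rightharpoonup V(H)$ with equal domains; it induces a partial isomorphism if $\alpha(z)\mapsto\beta(z)$ is a well-defined color-preserving isomorphism $G[\operatorname{im}\alpha]\to H[\operatorname{im}\beta]$. The bijective $(k_1,k_2)$-pebble game $\operatorname{BP}_{(k_1,k_2)}(G,H)$ between Spoiler (S) and Duplicator (D) starts from the empty configuration. A round with configuration $(\alpha,\beta)$: (1) S picks a pebble pair $z$ with $z\in[x_{k_1}]$ or $\alpha(z)$ undefined (if none exists, the winning condition is checked directly); (2) D chooses a bijection $f\colon V(G)\to V(H)$ (S wins if none exists); (3) S chooses $w\in V(G)$; (4) the configuration becomes $(\alpha[z/w],\beta[z/f(w)])$, i.e. pair $z$ is placed on $w$ and $f(w)$. S wins after a round if the configuration does not induce a partial isomorphism; D wins if S never wins. *)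

(* Defs.v *)
From mathcomp Require Import all_boot.

Set Implicit Arguments.
Unset Strict Implicit.
Unset Printing Implicit Defensive.

Record cgraph := CGraph {
  vertex :> finType;
  edge : rel vertex;
  color : vertex -> nat;
  edge_sym : symmetric edge;
  edge_irr : irreflexive edge }.

Record bijection (V W : Type) := Bijection {
  bij_fun :> V -> W;
  bij_funP : bijective bij_fun }.

(* inl x : reusable pair, inr y : non-reusable pair *)
Definition pebble (k1 k2 : nat) := ('I_k1 + 'I_k2)%type.

Definition reusable k1 k2 (z : pebble k1 k2) : bool :=
  if z is inl _ then true else false.

Section Game.
Variables (k1 k2 : nat) (G H : cgraph).

(* A pair of partial functions with equal domains, presented as one partial   *)
(* function to pairs: c z = Some (v, u) stands for alpha(z) = v, beta(z) = u. *)
Definition config := pebble k1 k2 -> option (G * H).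

Definition empty_config : config := fun _ => None.

Definition partial_isomorphism (c : config) : Prop :=
  forall z z' v u v' u', c z = Some (v, u) -> c z' = Some (v', u') ->
    [/\ v = v' <-> u = u', edge v v' = edge u u' & color v = color u].

Definition available (c : config) (z : pebble k1 k2) : bool :=
  reusable z || ~~ isSome (c z).

Record round := Round {
  rd_pebble : pebble k1 k2;
  rd_bij : bijection G H;
  rd_vertex : G }.

Definition history := seq round.

Definition update (c : config) (rd : round) : config :=
  [eta c with rd_pebble rd |-> Some (rd_vertex rd, rd_bij rd (rd_vertex rd))].

Definition config_of (h : history) : config := foldl update empty_config h.

Definition spoiler_won (h : history) : Prop :=
  ~ partial_isomorphism (config_of h).

(* Spoiler names the pair before seeing the bijection, the vertex after. *)
Record strategy := Strategy {
  pick : history -> pebble k1 k2;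
  place : history -> bijection G H -> G }.

Definition next_round (s : strategy) (h : history) (f : bijection G H) :=
  Round (pick s h) f (place s h f).

(* Spoiler, following s from h, wins after finitely many rounds whatever      *)
(* Duplicator does. When there is no bijection from V(G) to V(H) the second   *)
(* premise of wins_next is vacuous, so that Spoiler wins, as the rules ask.   *)
Inductive wins_from (s : strategy) (h : history) : Prop :=
| wins_now of spoiler_won h
| wins_next of available (config_of h) (pick s h)
    & (forall f, wins_from s (rcons h (next_round s h f))).

Definition winning (s : strategy) : Prop := wins_from s [::].

Definition play (s : strategy) (fs : seq (bijection G H)) : history :=
  foldl (fun h f => rcons h (next_round s h f)) [::] fs.

(* The play stops at Spoiler's first winning round. *)
Definition complete_play (s : strategy) (fs : seq (bijection G H)) : Prop :=
  spoiler_won (play s fs) /\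
  forall i, i < size fs -> ~ spoiler_won (play s (take i fs)).

End Game.

(* Number of uses of z in p after the last use of a non-reusable pair in p    *)
(* (in all of p when there is none).                                          *)
Definition recent_uses k1 k2 (z : pebble k1 k2) (p : seq (pebble k1 k2)) : nat :=
  count_mem z (take (find (fun z' => ~~ reusable z') (rev p)) (rev p)).

(* s lists the pairs used in a play, in order. All the non-reusable pairs are *)
(* used, and each time one is used, every reusable pair has been used at      *)
(* least t times since the previous non-reusable one (or since the start).    *)
Definition reuses_before_new k1 k2 (t : nat) (s : seq (pebble k1 k2)) : Prop :=
  (forall y : 'I_k2, inr y \in s) /\
  (forall (p q : seq (pebble k1 k2)) (y : 'I_k2), s = p ++ inr y :: q ->
     forall x : 'I_k1, t <= recent_uses (inl x) p).

(* Main.v *)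
(* The graphs are the untwisted and twisted Cai-Fuerer-Immerman graphs over a *)
(* base graph, so that the pebble game becomes the game of cops and robber on *)
(* the base graph, with k1 reusable and k2 non-reusable cops; the robber is   *)
(* the place where Duplicator hides the twist.                                *)
(*   The base graph is a tree of large arity in which a node is also joined   *)
(* to its nearest ancestors: the nearest k1 - 1 in general, and the nearest   *)
(* k1 at the end and at the beginning of each of k2 blocks of levels. Spoiler *)
(* chases the robber down the tree, k1 - 1 reusable cops guarding its subtree *)
(* while the remaining one is placed below; only at the end of a block does   *)
(* he need a non-reusable cop. Conversely the robber climbs back to the top   *)
(* of its block as soon as the guard is incomplete, so that it is driven to   *)
(* the end of the block only by moving the reusable cops in turn, many times. *)
(* If Spoiler uses a non-reusable cop earlier, the robber flees to a cop-free *)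
(* branch and stays around the k1 mutually adjacent nodes that end a block;   *)
(* there only non-reusable cops can drive it further, one per block, and      *)
(* Spoiler is now one short.                                                  *)

Require Import Defs.
From mathcomp Require Import all_boot zify.
From Stdlib Require Import Classical ClassicalEpsilon.

Set Implicit Arguments.
Unset Strict Implicit.
Unset Printing Implicit Defensive.

(** * Strategies from invariants *)

Section PebbleSequences.
Variables k1 k2 : nat.
Implicit Types (p : seq (pebble k1 k2)) (z : pebble k1 k2).

Definition reuses_before (t : nat) p : Prop :=
  forall p1 p2 y, p = p1 ++ inr y :: p2 ->
    forall x, t <= recent_uses (inl x) p1.

Lemma reuses_before_rcons t p z : reuses_before t p ->
    (forall y, z = inr y -> forall x, t <= recent_uses (inl x) p) ->
  reuses_before t (rcons p z).
Proof.
move=> rp last p1 p2 y; case/lastP: p2 => [|p2 z'].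
  by rewrite cats1 => /rcons_inj[<- /last].
by rewrite -rcons_cons -rcons_cat => /rcons_inj[ep _]; apply: rp ep.
Qed.

Lemma recent_uses_rcons z z' p : recent_uses z (rcons p z') =
  if reusable z' then (z' == z) + recent_uses z p else 0.
Proof. by rewrite /recent_uses rev_rcons /=; case: z'. Qed.

Lemma reuses_before_new_rcons t p z : reuses_before_new t p ->
  reusable z || (z \notin p) -> reuses_before_new t (rcons p z).
Proof.
move=> [all rb] av; split=> [y|]; first by rewrite mem_rcons inE all orbT.
by apply: reuses_before_rcons => // y zy; move: av; rewrite zy all.
Qed.

End PebbleSequences.

Section Strategies.
Variables (k1 k2 : nat) (G H : cgraph).
Implicit Types (s : strategy k1 k2 G H) (h : history k1 k2 G H).

Definition used h : seq (pebble k1 k2) := [seq rd_pebble rd | rd <- h].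

Lemma used_rcons h rd : used (rcons h rd) = rcons (used h) (rd_pebble rd).
Proof. exact: map_rcons. Qed.

Lemma config_of_rcons h rd : config_of (rcons h rd) = update (config_of h) rd.
Proof. exact: foldl_rcons. Qed.

Lemma config_of_used h z : isSome (config_of h z) = (z \in used h).
Proof.
elim/last_ind: h => [|h rd IH] //.
rewrite config_of_rcons used_rcons mem_rcons inE /update /=.
by case: eqVneq.
Qed.

Lemma play_rcons s fs f :
  play s (rcons fs f) = rcons (play s fs) (next_round s (play s fs) f).
Proof. exact: foldl_rcons. Qed.

Lemma winning_of_invariant (v0 : G) (N : nat) (pk : nat -> pebble k1 k2)
    (Inv : nat -> config k1 k2 G H -> Prop) :
    Inv 0 (@empty_config k1 k2 G H) ->
    (forall i c, Inv i c -> [/\ i < N, available c (pk i) &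
       forall f, exists v, let c' := update c (Round (pk i) f v) in
         partial_isomorphism c' -> Inv i.+1 c']) ->
  exists s, winning s.
Proof.
move=> inv0 invS.
pose good h f v := let c' := update (config_of h) (Round (pk (size h)) f v) in
  partial_isomorphism c' -> Inv (size h).+1 c'.
pose s := Strategy (fun h => pk (size h))
                   (fun h f => epsilon (inhabits v0) (good h f)).
exists s; rewrite /winning.
suff win d h : N - size h = d -> Inv (size h) (config_of h) -> wins_from s h.
  exact: (win _ [::] erefl inv0).
elim/ltn_ind: d h => d IH h Ed inv.
have [lt av ex] := invS _ _ inv.
apply: wins_next => // f; have := epsilon_spec (inhabits v0) _ (ex f).
rewrite -/(good h f) => gd.
case: (classic (partial_isomorphism (config_of (rcons h (next_round s h f))))).
  move=> iso; apply: (IH (N - (size h).+1)); rewrite ?size_rcons //; first lia.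
  by move: iso; rewrite config_of_rcons; apply: gd.
exact: wins_now.
Qed.

Lemma play_of_invariant s (J R : history k1 k2 G H -> Prop) :
    winning s -> J [::] ->
    (forall h, J h -> spoiler_won h -> R h) ->
    (forall h, J h -> available (config_of h) (Defs.pick s h) ->
       exists f, J (rcons h (next_round s h f))) ->
  exists fs, complete_play s fs /\ R (play s fs).
Proof.
move=> win J0 JR JS.
suff ext h : wins_from s h -> forall fs, h = play s fs -> J h ->
    (forall i, i < size fs -> ~ spoiler_won (play s (take i fs))) ->
    exists fs', complete_play s fs' /\ R (play s fs').
  exact: (ext _ win [::]).
elim=> {win}h => [won|av _ IH] fs eh Jh nw.
  by exists fs; rewrite /complete_play -eh; split=> //; apply: JR.
have [won|nwon] := classic (spoiler_won h).
  by exists fs; rewrite /complete_play -eh; split=> //; apply: JR.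
have [f Jf] := JS _ Jh av.
apply: (IH f (rcons fs f)) => //; first by rewrite play_rcons -eh.
move=> i; rewrite size_rcons ltnS leq_eqVlt => /predU1P[->|lt].
  by rewrite -cats1 take_size_cat // -eh.
by rewrite -cats1 takel_cat; [apply: nw|exact: ltnW].
Qed.

End Strategies.

(** * Cai-Fuerer-Immerman graphs and the robber *)

Section CFI.
Variables (V : finType) (adj : rel V) (root : V).
Hypotheses (adj_sym : symmetric adj) (adj_irr : irreflexive adj).
Implicit Types (n m v rho : V) (a b : {ffun V -> bool}).

Definition parity n a : bool := \big[addb/false]_(m | adj n m) a m.

Definition shift a b : {ffun V -> bool} := [ffun m => a m (+) b m].

Lemma parity_shift n a b : parity n (shift a b) = parity n a (+) parity n b.
Proof.
by rewrite /parity -big_split; apply: eq_bigr => m _; rewrite ffunE.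
Qed.

Lemma parity0 n : parity n [ffun=> false] = false.
Proof. by rewrite /parity big1 // => m _; rewrite ffunE. Qed.

Lemma parity_point n v (e : bool) :
  parity n [ffun m => e && (m == v)] = e && adj n v.
Proof.
rewrite /parity (eq_bigr (fun m => e && (m == v))); last first.
  by move=> m _; rewrite ffunE.
case: e => /=; last by rewrite big1.
rewrite big_mkcond (bigD1 v) //= eqxx.
by rewrite big1 ?addbF => [|m /negPf->]; case: adj.
Qed.

Lemma shiftK b : cancel (shift^~ b) (shift^~ b).
Proof. by move=> a; apply/ffunP=> m; rewrite !ffunE -addbA addbb addbF. Qed.

Lemma shift0 a : shift a [ffun=> false] = a.
Proof. by apply/ffunP=> m; rewrite !ffunE addbF. Qed.

Definition cfi_edge : rel (V * {ffun V -> bool}) :=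
  fun p q => adj p.1 q.1 && (p.2 q.1 == q.2 p.1).

Lemma cfi_edge_sym : symmetric cfi_edge.
Proof. by move=> p q; rewrite /cfi_edge adj_sym eq_sym. Qed.

Lemma cfi_edge_irr : irreflexive cfi_edge.
Proof. by move=> p; rewrite /cfi_edge adj_irr. Qed.

Definition cfi (twist : bool) : cgraph :=
  @CGraph (V * {ffun V -> bool})%type cfi_edge
    (fun p => pickle (p.1, parity p.1 p.2 (+) (twist && (p.1 == root))))
    cfi_edge_sym cfi_edge_irr.

Variables k1 k2 : nat.
Local Notation peb := (pebble k1 k2).
Local Notation config := (config k1 k2 (cfi false) (cfi true)).
Local Notation history := (history k1 k2 (cfi false) (cfi true)).
Implicit Types (z : peb) (c : config) (h : history).

Definition copmap := {ffun peb -> option V}.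
Implicit Type P : copmap.

Definition lift_cop P z : copmap := [ffun z' => if z' == z then None else P z'].
Definition land_cop P z v : copmap :=
  [ffun z' => if z' == z then Some v else P z'].

Definition free P n : bool := [forall z, P z != Some n].

Lemma freePn P n : reflect (exists z, P z = Some n) (~~ free P n).
Proof.
rewrite /free negb_forall.
apply: (iffP existsP) => -[z Pz]; exists z; first exact/eqP/negPn.
by rewrite Pz eqxx.
Qed.

Lemma free_lift P z n : free P n -> free (lift_cop P z) n.
Proof.
apply: contraLR => /freePn[z']; rewrite ffunE; case: ifP => // _ Pz'.
by apply/freePn; exists z'.
Qed.

Lemma free_land P z v n :
  free (land_cop P z v) n = (n != v) && free (lift_cop P z) n.
Proof.
apply: negb_inj; rewrite negb_and negbK.
apply/freePn/predU1P => [[z']|[->|/freePn[z']]].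
- rewrite ffunE; case: ifP => z'z Pz'; first by left; case: Pz'.
  by right; apply/freePn; exists z'; rewrite ffunE z'z.
- by exists z; rewrite ffunE eqxx.
- by rewrite ffunE; case: ifP => // z'z Pz'; exists z'; rewrite ffunE z'z.
Qed.

Definition escape P : rel V := connect [rel m m' | adj m m' && free P m'].

Lemma escape1 P n m : adj n m -> free P m -> escape P n m.
Proof. by move=> nm frm; apply: connect1; rewrite /= nm. Qed.

Lemma escape_homo P (Q : V -> Prop) :
    (forall n m, adj n m -> free P m -> Q n -> Q m) ->
  forall n m, escape P n m -> Q n -> Q m.
Proof.
move=> step n m /connectP[p + ->].
elim: p n => //= n' p IH n /andP[/andP[nn' fr] pth] Qn.
exact: IH pth (step _ _ nn' fr Qn).
Qed.

(* Shifting by [beta] moves the twist of [cfi true] from [root] to [rho].     *)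
Definition carries_twist (beta : V -> {ffun V -> bool}) rho : Prop :=
  (forall n m, beta n m = beta m n) /\
  (forall n, parity n (beta n) = (n == root) (+) (n == rho)).

Lemma carries_twist0 : carries_twist (fun=> [ffun=> false]) root.
Proof. by split=> [n m|n]; rewrite ?ffunE // parity0 addbb. Qed.

Definition flip rho rho' n : {ffun V -> bool} :=
  shift [ffun m => (n == rho) && (m == rho')]
        [ffun m => (n == rho') && (m == rho)].

Lemma flip_out rho rho' n :
  n != rho -> n != rho' -> flip rho rho' n = [ffun=> false].
Proof.
by move=> /negPf nr /negPf nr'; apply/ffunP=> m; rewrite !ffunE nr nr'.
Qed.

Lemma carries_twist_flip beta rho rho' : adj rho rho' ->
  carries_twist beta rho ->
  carries_twist (fun n => shift (beta n) (flip rho rho' n)) rho'.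
Proof.
move=> rr' [bsym bpar]; split=> [n m|n].
  rewrite !ffunE bsym; congr (_ (+) _).
  by rewrite addbC (andbC (n == rho)) (andbC (n == rho')).
rewrite !parity_shift bpar !parity_point -addbA; congr (_ (+) _).
have ne : rho == rho' = false by apply: contraTF rr' => /eqP<-; rewrite adj_irr.
case: (eqVneq n rho) => [->|_]; first by rewrite rr' ne.
by case: eqVneq => // ->; rewrite adj_sym rr'.
Qed.

Definition shifted_by (beta : V -> {ffun V -> bool}) c : Prop :=
  forall z p q, c z = Some (p, q) -> q = (p.1, shift p.2 (beta p.1)).

Definition cops c : copmap := [ffun z => omap (fun p => p.1.1) (c z)].

(* [beta] is an isomorphism up to the parity of the gadget at [rho].          *)
Definition robber_at c rho : Prop :=
  free (cops c) rho /\ exists2 beta, carries_twist beta rho & shifted_by beta c.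

Lemma cops_free c rho z p q :
  free (cops c) rho -> c z = Some (p, q) -> p.1 != rho.
Proof.
by move=> /forallP/(_ z); rewrite ffunE => + cz; rewrite cz.
Qed.

Lemma robber_at_iso c rho : robber_at c rho -> partial_isomorphism c.
Proof.
move=> [fr [beta [bsym bpar] sh]] z z' [n a] u [n' a'] u' cz cz'.
have /= nr := cops_free fr cz.
have {sh} [-> ->] := (sh _ _ _ cz, sh _ _ _ cz'); split=> /=.
- by split=> [[-> ->]// |[e]]; rewrite e => /(can_inj (shiftK _)) ->.
- rewrite /cfi_edge /= !ffunE (bsym n n').
  by case: (a n') (a' n) (beta n' n) => [] [] [].
- congr (pickle (_, _)); rewrite parity_shift bpar (negPf nr).
  by case: (parity n a) (n == root) => [] [].
Qed.

Lemma robber_at_escape c rho rho' :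
  escape (cops c) rho rho' -> robber_at c rho -> robber_at c rho'.
Proof.
apply: escape_homo => {}rho {}rho' rr' fr' [fr [beta bt sh]]; split=> //.
exists (fun n => shift (beta n) (flip rho rho' n)).
  exact: carries_twist_flip.
move=> z p q cz; rewrite (sh _ _ _ cz).
by rewrite flip_out ?shift0 // (cops_free _ cz).
Qed.

Definition lift_config c z : config := [eta c with z |-> None].

Lemma cops_lift c z : cops (lift_config c z) = lift_cop (cops c) z.
Proof. by apply/ffunP=> z'; rewrite !ffunE /lift_config /=; case: eqP. Qed.

Lemma cops_update c rd :
  cops (update c rd) = land_cop (cops c) (rd_pebble rd) (rd_vertex rd).1.
Proof. by apply/ffunP=> z; rewrite !ffunE /update /=; case: eqP. Qed.

Lemma robber_at_lift c z rho :
  robber_at c rho -> robber_at (lift_config c z) rho.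
Proof.
move=> [fr [beta bt sh]]; split; first by rewrite cops_lift free_lift.
exists beta => // z' p q; rewrite /lift_config /=.
by case: eqP => // _; apply: sh.
Qed.

Lemma cops_empty : cops (@empty_config _ _ _ _) = [ffun=> None].
Proof. by apply/ffunP=> z; rewrite !ffunE. Qed.

Lemma robber_at_root : robber_at (@empty_config _ _ _ _) root.
Proof.
split; first by apply/forallP=> z; rewrite ffunE.
by exists (fun=> [ffun=> false]); first exact: carries_twist0.
Qed.

Definition shift_bij_fun (g : {ffun V -> {ffun V -> bool}})
  (p : cfi false) : cfi true := (p.1, shift p.2 (g p.1)).

Lemma shift_bij_fun_bij g : bijective (shift_bij_fun g).
Proof.
exists (fun p : cfi true => (p.1, shift p.2 (g p.1)) : cfi false);
  by case=> n a; rewrite /shift_bij_fun /= shiftK.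
Qed.

Definition shift_bij g : bijection (cfi false) (cfi true) :=
  Bijection (shift_bij_fun_bij g).

Definition can_dodge P z v rho (Q : V -> Prop) : Prop :=
  exists rho', [/\ rho' != v, escape (lift_cop P z) rho rho' & Q rho'].

Lemma can_dodge_imply P z v rho (Q Q' : V -> Prop) :
  (forall n, Q n -> Q' n) -> can_dodge P z v rho Q -> can_dodge P z v rho Q'.
Proof. by move=> QQ' [rho' [ne esc /QQ' q]]; exists rho'. Qed.

(* Only the image of the pebbled gadget matters, so Duplicator may glue the   *)
(* answers that he prepares for the various gadgets into one bijection: the   *)
(* robber moves after hearing where the cop will land.                        *)
Lemma robber_move c rho z (Q : V -> V -> Prop) :
    robber_at c rho -> (forall v, can_dodge (cops c) z v rho (Q v)) ->
  exists f, forall w, exists2 rho', robber_at (update c (Round z f w)) rho' &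
    Q w.1 rho'.
Proof.
move=> rob dodge; pose c' := lift_config c z.
have : forall v, exists rb : V * (V -> {ffun V -> bool}),
    [/\ free (land_cop (cops c) z v) rb.1, Q v rb.1,
        carries_twist rb.2 rb.1 & shifted_by rb.2 c'].
  move=> v; have [rho' [ne esc q]] := dodge v; rewrite -cops_lift in esc.
  have [fr [beta bt sh]] := robber_at_escape esc (robber_at_lift z rob).
  by exists (rho', beta); split=> //; rewrite free_land ne -cops_lift.
case/fin_all_exists => F prepared.
exists (shift_bij [ffun v => (F v).2 v]) => -[v a].
have [fr q bt sh] := prepared v; exists (F v).1 => //.
rewrite /robber_at cops_update; split=> //; exists (F v).2 => // z' p u.
rewrite /update /=; case: (eqVneq z' z) => [_ [<- <-]|nz cz'].
  by rewrite /shift_bij_fun ffunE.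
by apply: (sh z'); rewrite /c' /lift_config /= (negPf nz).
Qed.

Theorem play_of_robber (inv : seq peb -> copmap -> V -> Prop)
    (enough : seq peb -> Prop)
    (s : strategy k1 k2 (cfi false) (cfi true)) :
    winning s -> inv [::] [ffun=> None] root ->
    (forall p z, enough p -> reusable z || (z \notin p) ->
       enough (rcons p z)) ->
    (forall p P rho z v, (forall z', isSome (P z') = (z' \in p)) ->
       inv p P rho -> free P rho -> reusable z || (z \notin p) ->
       can_dodge P z v rho (fun rho' =>
         inv (rcons p z) (land_cop P z v) rho' \/ enough (rcons p z))) ->
  exists fs, complete_play s fs /\ enough (used (play s fs)).
Proof.
move=> win inv0 enoughS invS.
pose J h := (exists2 rho, robber_at (config_of h) rho &
              inv (used h) (cops (config_of h)) rho) \/ enough (used h).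
apply: (play_of_invariant (J := J) (R := fun h => enough (used h)) win).
- left; exists root; first exact: robber_at_root.
  by rewrite [cops _]cops_empty.
- by move=> h [[rho rob _]|//] []; apply: robber_at_iso rob.
move=> h Jh; rewrite /available config_of_used; set z := Defs.pick s h => av.
case: Jh => [[rho rob inv_rho]|done_h]; last first.
  exists (shift_bij [ffun=> [ffun=> false]]).
  by right; rewrite used_rcons; apply: enoughS.
have placed z' : isSome (cops (config_of h) z') = (z' \in used h).
  by rewrite -config_of_used ffunE; case: (config_of h z').
have dodge v := invS _ _ _ z v placed inv_rho rob.1 av.
have [f survives] := robber_move rob dodge.
exists f; have [rho' rob' q] := survives (place s h f).
rewrite /J used_rcons config_of_rcons cops_update /=.
by case: q => [inv_rho'|]; [left; exists rho'|right].
Qed.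

End CFI.

(** * Trees and nearby ancestors *)

Section Tree.
Variables d N : nat.

Definition node : finType := N.-bseq 'I_d.
Implicit Types (a m n p r s u v : node) (i : 'I_d).

Definition root : node := [bseq].
Definition depth u : nat := size u.
Definition anc : rel node := fun u v => prefix u v.
Definition proper_anc u v := anc u v && (depth u < depth v).
Definition is_child u v := anc u v && (depth v == (depth u).+1).

Lemma depth_le u : depth u <= N.
Proof. exact: size_bseq. Qed.

Lemma anc_refl : reflexive anc.
Proof. by move=> u; apply: prefix_refl. Qed.

Lemma anc_trans : transitive anc.
Proof. by move=> v u a; apply: prefix_trans. Qed.

Lemma anc_depth u v : anc u v -> depth u <= depth v.
Proof. exact: size_prefix. Qed.

Lemma anc_comparable u v a :
  anc u a -> anc v a -> depth u <= depth v -> anc u v.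
Proof.
rewrite /anc /depth !prefixE => /eqP ua /eqP va le.
by rewrite -{1}va take_takel // ua.
Qed.

Lemma anc_depth_eq u v : anc u v -> depth v <= depth u -> u = v.
Proof.
rewrite /anc prefixE => /eqP uv le; apply: val_inj.
by rewrite /= -uv take_oversize.
Qed.

Lemma anc_eqVproper u v : anc u v = (u == v) || proper_anc u v.
Proof.
rewrite /proper_anc; case: eqVneq => [->|ne]; first by rewrite anc_refl.
case uv: (anc u v) => //=; apply/esym; rewrite ltnNge.
by apply: contra_neqN ne => /(anc_depth_eq uv).
Qed.

Lemma proper_ancE u v : proper_anc u v = anc u v && (u != v).
Proof.
rewrite anc_eqVproper; case: eqVneq => [->|] /=; last by rewrite andbT.
by rewrite /proper_anc ltnn andbF.
Qed.

Lemma is_child_proper u v : is_child u v -> proper_anc u v.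
Proof. by case/andP=> uv /eqP vu; rewrite /proper_anc uv vu ltnSn. Qed.

Lemma depth_child u v : is_child u v -> depth v = (depth u).+1.
Proof. by case/andP=> _ /eqP. Qed.

Lemma proper_anc_child n n' p : is_child n n' -> proper_anc p n' = anc p n.
Proof.
move=> /[dup] /is_child_proper/andP[nn' _] /depth_child dn'.
rewrite /proper_anc dn' ltnS; apply/andP/idP => [[pn' le]|pn].
  exact: anc_comparable nn' le.
by split; [apply: anc_trans nn' | apply: anc_depth].
Qed.

Definition anc_at a (k : nat) : node := insubd a (take k a).

Lemma val_anc_at a k : anc_at a k = take k a :> seq 'I_d.
Proof.
rewrite val_insubd ifT // (leq_trans _ (depth_le a)) //.
by rewrite size_take_min geq_minr.
Qed.

Lemma anc_anc_at a k : anc (anc_at a k) a.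
Proof. by rewrite /anc val_anc_at prefix_take. Qed.

Lemma depth_anc_at a k : k <= depth a -> depth (anc_at a k) = k.
Proof. by rewrite /depth val_anc_at size_take_min => /minn_idPl. Qed.

Lemma anc_at_depth n a : anc n a -> anc_at a (depth n) = n.
Proof.
by rewrite /anc prefixE => /eqP na; apply: val_inj; rewrite /= val_anc_at na.
Qed.

Definition child n i : node := insubd n (rcons n i).

Lemma val_child n i : depth n < N -> child n i = rcons n i :> seq 'I_d.
Proof. by move=> lt; rewrite val_insubd size_rcons ifT. Qed.

Lemma is_child_child n i : depth n < N -> is_child n (child n i).
Proof.
move=> lt; rewrite /is_child /anc /depth val_child //.
by rewrite prefix_rcons size_rcons eqxx.
Qed.

Lemma child_inj n : depth n < N -> injective (child n).
Proof.
by move=> lt i j /(congr1 val); rewrite /= !val_child // => /rcons_inj[].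
Qed.

Lemma big_proper_desc (R : Type) (idx : R) (op : Monoid.com_law idx) n
    (F : node -> R) :
  \big[op/idx]_(m | proper_anc n m) F m =
  \big[op/idx]_(n' | is_child n n') \big[op/idx]_(m | anc n' m) F m.
Proof.
rewrite (partition_big (fun m => anc_at m (depth n).+1) (is_child n)).
  apply: eq_bigr => n' /[dup] /depth_child dn' /is_child_proper /andP[nn' lt].
  apply: eq_bigl => m; apply/andP/idP => [[_ /eqP <-]|n'm].
    exact: anc_anc_at.
  rewrite -dn' anc_at_depth // /proper_anc (anc_trans nn' n'm).
  by rewrite (leq_trans lt (anc_depth n'm)).
move=> m /andP[nm lt]; have dm := depth_anc_at lt.
by rewrite /is_child dm (anc_comparable nm (anc_anc_at _ _)) ?dm ?eqxx.
Qed.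

Definition subtree s : {set node} := [set n | anc s n].

Definition lineage a (k : nat) : {set node} :=
  [set n | anc n a & depth a - depth n < k].

Lemma card_lineage a k : k <= (depth a).+1 -> #|lineage a k| = k.
Proof.
move=> le; pose up (j : 'I_k) := anc_at a (depth a - j).
have depth_up j : depth (up j) = depth a - j by rewrite depth_anc_at ?leq_subr.
have up_inj : injective up.
  move=> j j' /(congr1 depth); rewrite !depth_up => e; apply: val_inj => /=.
  by have := ltn_ord j; have := ltn_ord j'; lia.
rewrite -[RHS]card_ord -cardsT -(card_imset _ up_inj).
apply: eq_card => n; rewrite inE; apply/andP/imsetP => [[na lt]|[j _ ->]].
  exists (Ordinal lt) => //; rewrite /up /= -[LHS](anc_at_depth na).
  by congr anc_at; have := anc_depth na; lia.
by rewrite depth_up anc_anc_at; split=> //; have := ltn_ord j; lia.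
Qed.

Lemma card_proper_lineage a k : k <= depth a -> #|lineage a k.+1 :\ a| = k.
Proof.
move=> le; apply/eqP; rewrite -eqSS -[X in _ == X](@card_lineage a k.+1) //.
by rewrite (cardsD1 a (lineage a k.+1)) inE anc_refl subnn.
Qed.

Lemma lineage_subtree r a k : anc r a -> depth r + k <= (depth a).+1 ->
  lineage a k \subset subtree r.
Proof.
move=> ra le; apply/subsetP=> n; rewrite !inE => /andP[na lt].
by apply: anc_comparable ra na _; lia.
Qed.

Variable reach : nat -> nat.

Definition near_anc u v :=
  proper_anc u v && (depth v - depth u <= reach (depth v)).

Definition tree_adj : rel node := fun u v => near_anc u v || near_anc v u.

Lemma tree_adj_sym : symmetric tree_adj.
Proof. by move=> u v; rewrite /tree_adj orbC. Qed.

Lemma tree_adj_irr : irreflexive tree_adj.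
Proof. by move=> u; rewrite /tree_adj /near_anc /proper_anc ltnn andbF. Qed.

Lemma near_anc_proper u v : near_anc u v -> proper_anc u v.
Proof. by case/andP. Qed.

Lemma proper_near_anc u v : proper_anc u v && near_anc u v = near_anc u v.
Proof. by rewrite /near_anc andbA andbb. Qed.

Lemma near_anc_asym u v : near_anc u v -> near_anc v u = false.
Proof.
move=> /near_anc_proper/andP[_ lt].
by apply/negbTE; apply/negP => /near_anc_proper/andP[_]; lia.
Qed.

Lemma parity_tree n (a : {ffun node -> bool}) : parity tree_adj n a =
  \big[addb/false]_(m | near_anc n m) a m (+)
  \big[addb/false]_(p | near_anc p n) a p.
Proof.
rewrite /parity (bigID (near_anc n)) /=; congr (_ (+) _); apply: eq_bigl => m.
  by rewrite /tree_adj; case: (near_anc n m); rewrite ?andbF.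
rewrite /tree_adj andb_orl andbN /=.
by case mn: (near_anc m n); rewrite // (near_anc_asym mn).
Qed.

End Tree.

(** * Spoiler sweeps the tree *)

Section Sweep.
Variables (d N : nat) (reach : nat -> nat) (k1 k2 : nat).
Local Notation node := (node d N).
Local Notation root := (root d N).
Local Notation near_anc := (@near_anc d N reach).
Local Notation tree_adj := (@tree_adj d N reach).
Implicit Types (m n p : node) (a : {ffun node -> bool}).
Implicit Types (b : node -> {ffun node -> bool}).

Definition tree_cfi : bool -> cgraph :=
  cfi root (@tree_adj_sym d N reach) (@tree_adj_irr d N reach).

Local Notation config := (config k1 k2 (tree_cfi false) (tree_cfi true)).
Implicit Types (c : config) (f : bijection (tree_cfi false) (tree_cfi true)).

Definition inflow n b m : bool :=
  \big[addb/false]_(p | proper_anc p n && near_anc p m) b p m.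

(* When the shifts [b] of the gadgets above [n] make it odd, the robber is in *)
(* the subtree of [n].                                                        *)
Definition subtree_odd n b : bool :=
  (n == root) (+) \big[addb/false]_(m | anc n m) inflow n b m.

Lemma inflow_child n n' b a m : is_child n n' ->
  inflow n' [eta b with n |-> a] m = (near_anc n m && a m) (+) inflow n b m.
Proof.
move=> nn'; rewrite /inflow (bigID (pred1 n)) /=; congr (_ (+) _).
  rewrite (eq_bigl (fun p => (p == n) && near_anc n m)); last first.
    move=> p; rewrite (proper_anc_child p nn').
    by case: eqVneq => [->|]; rewrite ?anc_refl ?andbT ?andbF.
  by rewrite big_mkcondr big_pred1_eq /= eqxx; case: near_anc.
apply: eq_big => [p|p /andP[_ /negPf->] //].
by rewrite (proper_anc_child p nn') proper_ancE andbAC.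
Qed.

Lemma subtree_odd_children n b a :
    parity tree_adj n a = (n == root) ->
    (forall p, near_anc p n -> b p n = a p) ->
  \big[addb/false]_(n' | is_child n n') subtree_odd n' [eta b with n |-> a] =
  subtree_odd n b.
Proof.
rewrite parity_tree => par agree.
have inflow_n : inflow n b n = \big[addb/false]_(p | near_anc p n) a p.
  by rewrite -(eq_bigr _ agree); apply: eq_bigl => p; apply: proper_near_anc.
have oddE : subtree_odd n b = (n == root) (+)
    (inflow n b n (+) \big[addb/false]_(m | proper_anc n m) inflow n b m).
  rewrite /subtree_odd (bigD1 n) ?anc_refl //=; congr (_ (+) (_ (+) _)).
  by apply: eq_bigl => m; rewrite proper_ancE eq_sym.
have childE n' : is_child n n' -> subtree_odd n' [eta b with n |-> a] =
    \big[addb/false]_(m | anc n' m) ((near_anc n m && a m) (+) inflow n b m).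
  move=> nn'; rewrite /subtree_odd; case: eqVneq => [n'0|_].
    by have := depth_child nn'; rewrite n'0.
  by rewrite addFb; apply: eq_bigr => m _; apply: inflow_child.
rewrite (eq_bigr _ childE) -big_proper_desc big_split /= oddE -par inflow_n.
rewrite -big_mkcondr (eq_bigl _ _ (proper_near_anc reach n)).
by rewrite -addbA addKb.
Qed.

Lemma odd_child n b a :
    parity tree_adj n a = (n == root) ->
    (forall p, near_anc p n -> b p n = a p) -> subtree_odd n b ->
  exists2 n', is_child n n' & subtree_odd n' [eta b with n |-> a].
Proof.
move=> par agree; rewrite -(subtree_odd_children par agree) => odd.
apply/exists_inP; apply: contraTT odd => /exists_inPn even.
by rewrite big1 // => n' /even/negPf.
Qed.

(* Round [i] is played on a node of depth [i].                                *)
Variable sched : nat -> pebble k1 k2.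

Definition undisturbed (j i : nat) : Prop :=
  forall j', j < j' < i -> sched j' <> sched j.

Hypothesis sched_once : forall i j, i < j <= N -> ~~ reusable (sched j) ->
  sched i <> sched j.
Hypothesis sched_undisturbed : forall i j, j < i <= N -> i - j <= reach i ->
  undisturbed j i.+1.

Definition probe n : tree_cfi false := (n, [ffun=> false]).

Definition swept i c n b : Prop :=
  [/\ depth n = i,
      forall p, proper_anc p n -> undisturbed (depth p) i ->
        c (sched (depth p)) = Some (probe p, (p, b p)),
      forall z, (forall j, j < i -> sched j <> z) -> c z = None &
      subtree_odd n b].

Definition sweeping i c : Prop := exists n b, swept i c n b.

Lemma sweeping0 : sweeping 0 (@empty_config _ _ _ _).
Proof.
exists root, (fun=> [ffun=> false]); split=> //.
  by move=> p /andP[].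
rewrite /subtree_odd eqxx big1 // => m _; apply: big1 => p _.
by rewrite ffunE.
Qed.

Lemma sweeping_available i c : sweeping i c -> available c (sched i).
Proof.
move=> [n [b [dn _ new _]]]; rewrite /available.
have [//|nonreusable] := boolP (reusable (sched i)).
by rewrite new // => j lt; apply: sched_once; rewrite // lt -dn depth_le.
Qed.

Lemma swept_answer i c n b f m a : swept i c n b ->
    f (probe n) = (m, a) ->
    partial_isomorphism (update c (Round (sched i) f (probe n))) ->
  [/\ m = n, parity tree_adj n a = (n == root) &
      forall p, near_anc p n -> b p n = a p].
Proof.
move=> [dn old _ _] fn; set c' := update _ _ => iso.
have cn : c' (sched i) = Some (probe n, (m, a)).
  by rewrite /c' /update /= eqxx fn.
have [_ _ /(pcan_inj pickleK) /= [mn par]] := iso _ _ _ _ _ _ cn cn.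
rewrite -{m}mn in fn cn par *; split=> // [|p pn].
  by move: par; rewrite parity0; case: (parity _ n a) (n == root) => [] [].
have /andP[/[dup] proper_pn /andP[_ lt] near] := pn; rewrite dn in lt near.
have live : undisturbed (depth p) i.+1.
  by apply: sched_undisturbed; rewrite // lt -dn depth_le.
have cp : c' (sched (depth p)) = Some (probe p, (p, b p)).
  rewrite /c' /update /= ifN; last by apply/eqP/nesym/live; rewrite lt /=.
  by apply: old => // j /andP[ltj ltji]; apply: live; rewrite ltj ltnW.
have [_ + _] := iso _ _ _ _ _ _ cp cn.
by rewrite /= /cfi_edge /= /tree_adj pn /= !ffunE eqxx => /esym/eqP.
Qed.

Lemma swept_child i c n b f a n' : swept i c n b ->
    f (probe n) = (n, a) ->
    is_child n n' -> subtree_odd n' [eta b with n |-> a] ->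
  swept i.+1 (update c (Round (sched i) f (probe n))) n'
    [eta b with n |-> a].
Proof.
move=> [dn old new _] fn nn' odd'; split=> //.
- by rewrite (depth_child nn') dn.
- move=> p; rewrite (proper_anc_child p nn') anc_eqVproper.
  case/predU1P => [->|proper_pn] live.
    by rewrite /update /= dn !eqxx fn.
  have /andP[_ lt] := proper_pn; rewrite dn in lt.
  have /negPf pn : p != n by move: proper_pn; rewrite proper_ancE => /andP[].
  rewrite /update /= pn ifN; last by apply/eqP/nesym/live; rewrite lt /=.
  by apply: old => // j /andP[ltj ltji]; apply: live; rewrite ltj ltnW.
- move=> z unused_z; rewrite /update /= ifN.
    by apply: new => j lt; apply/unused_z/ltnW.
  by apply/eqP/nesym/unused_z.
Qed.

Lemma sweepingS i c : sweeping i c ->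
  forall f, exists v, let c' := update c (Round (sched i) f v) in
    partial_isomorphism c' -> sweeping i.+1 c'.
Proof.
move=> [n [b sw]] f; exists (probe n) => /= iso.
case fn: (f (probe n)) => [m a].
have [mn par agree] := swept_answer sw fn iso; rewrite {m}mn in fn.
have [_ _ _ odd] := sw; have [n' nn' odd'] := odd_child par agree odd.
by exists n', [eta b with n |-> a]; apply: swept_child.
Qed.

Theorem sweep_wins :
  exists s : strategy k1 k2 (tree_cfi false) (tree_cfi true), winning s.
Proof.
apply: (winning_of_invariant (probe root) (N := N.+1) sweeping0) => i c sw.
split; last exact: sweepingS.
- by have [n [b [<- _ _ _]]] := sw; rewrite ltnS depth_le.
- exact: sweeping_available.
Qed.

End Sweep.

(** * Cops on the tree *)

Section Guards.
Variables (V : finType) (k1 k2 : nat).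
Implicit Types (P : copmap V k1 k2) (S : {set V}).
Implicit Types (x : 'I_k1) (y : 'I_k2) (v : V).

Definition unused P : nat := #|[set y | ~~ isSome (P (inr y))]|.

Lemma unused_land_new P y v : P (inr y) = None ->
  unused P = (unused (land_cop P (inr y) v)).+1.
Proof.
move=> Py; rewrite /unused (cardsD1 y) inE Py /= add1n; congr _.+1.
by apply: eq_card => y'; rewrite !inE ffunE (inj_eq (@inr_inj _ _)); case: eqP.
Qed.

Lemma unused_land_reusable P x v : unused (land_cop P (inl x) v) = unused P.
Proof. by apply: eq_card => y; rewrite !inE ffunE. Qed.

Definition new_avoid P S : Prop :=
  forall y n, P (inr y) = Some n -> n \notin S.

Lemma new_avoid_land_reusable P x v S :
  new_avoid P S -> new_avoid (land_cop P (inl x) v) S.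
Proof. by move=> avS y n; rewrite ffunE; apply: avS. Qed.

Lemma new_avoid_subset P S S' :
  S \subset S' -> new_avoid P S' -> new_avoid P S.
Proof. by move=> /subsetP SS' av y n /av; apply: contra; apply: SS'. Qed.

Definition guarded P x S : Prop :=
  forall n, n \in S -> exists2 x', x' != x & P (inl x') = Some n.

Lemma guarded_subset P x S S' : S \subset S' -> guarded P x S' -> guarded P x S.
Proof. by move=> /subsetP SS' guard n /SS'; apply: guard. Qed.

Lemma guarded_lift P x S : new_avoid P S ->
  (forall n, n \in S -> ~~ free (lift_cop P (inl x)) n) -> guarded P x S.
Proof.
move=> avS taken n nS; have /freePn[[x'|y]] := taken n nS; rewrite ffunE.
  by case: eqVneq => // ne Px'; exists x'; first by apply: contraNneq ne => ->.
by move=> /= Py; move: (avS _ _ Py); rewrite nS.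
Qed.

Definition guards P x S : {set 'I_k1} :=
  [set x' | (x' != x) && (P (inl x') \in [set Some n | n in S])].

Lemma guards_subset P x S : guards P x S \subset [set~ x].
Proof. by apply/subsetP=> x'; rewrite !inE => /andP[]. Qed.

Lemma card_guards P x S : guarded P x S -> #|S| <= #|guards P x S|.
Proof.
move=> guard; rewrite -(card_imset _ (@Some_inj _)).
apply: leq_trans (leq_imset_card (fun x' => P (inl x')) _).
apply/subset_leq_card/subsetP=> _ /imsetP[n nS ->].
have [x' ne Px'] := guard n nS; apply/imsetP; exists x' => //.
by rewrite inE ne Px' imset_f.
Qed.

Lemma card_guarded P x S : guarded P x S -> #|S| < k1.
Proof.
move=> /card_guards le; have := subset_leq_card (guards_subset P x S).
rewrite cardsC1 card_ord => /(leq_trans le); have := ltn_ord x; lia.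
Qed.

Lemma guarded_all P x S : guarded P x S -> #|S|.+1 = k1 ->
  forall x', x' != x -> exists2 n, n \in S & P (inl x') = Some n.
Proof.
move=> /card_guards le cardS x' ne.
suff guardsE : guards P x S = [set~ x].
  have : x' \in guards P x S by rewrite guardsE !inE.
  by rewrite inE => /andP[_ /imsetP[n nS Px']]; exists n.
apply/eqP; rewrite eqEcard guards_subset cardsC1 card_ord.
by apply: leq_trans le; rewrite -cardS.
Qed.

Lemma exists_free_lift P x S : new_avoid P S -> k1 <= #|S| ->
  exists2 n, n \in S & free (lift_cop P (inl x)) n.
Proof.
move=> avS le; apply/exists_inP; apply: contraLR le => /exists_inPn taken.
by rewrite -ltnNge; apply: (@card_guarded P x); apply: guarded_lift.
Qed.

End Guards.

Section Robber.
Variables (d N : nat) (reach : nat -> nat) (k1 k2 : nat).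
Hypothesis reach_gt0 : forall k, 0 < reach k.
Hypothesis pebbles_lt_arity : k1 + k2 < d.
Local Notation node := (node d N).
Local Notation escape := (escape (@tree_adj d N reach)).
Implicit Types (P : copmap node k1 k2) (a n r s v rho : node).
Implicit Type z : pebble k1 k2.

Lemma tree_adj_child n r : is_child n r -> @tree_adj d N reach n r.
Proof.
move=> /[dup] /depth_child dr /is_child_proper nr.
by rewrite /tree_adj /near_anc nr dr subSnn reach_gt0.
Qed.

Definition clean P r : bool := [forall n, anc r n ==> free P n].

Lemma clean_free P r n : clean P r -> anc r n -> free P n.
Proof. by move=> /forall_inP; apply. Qed.

Lemma clean_cop P r z n : clean P r -> P z = Some n -> ~~ anc r n.
Proof.
by move=> cl Pz; apply/negP=> /(clean_free cl); apply/negP/freePn; exists z.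
Qed.

Lemma clean_anc P r r' : clean P r -> anc r r' -> clean P r'.
Proof.
move=> cl rr'; apply/forall_inP=> n r'n.
exact: clean_free cl (anc_trans rr' r'n).
Qed.

Lemma clean_lift P z v r : clean (land_cop P z v) r -> clean (lift_cop P z) r.
Proof.
move=> cl; apply/forall_inP=> n rn.
by have := clean_free cl rn; rewrite free_land => /andP[].
Qed.

Lemma clean_neq P z v r n : clean (land_cop P z v) r -> anc r n -> n != v.
Proof. by move=> cl /(clean_free cl); rewrite free_land => /andP[]. Qed.

Lemma new_avoid_clean P r : clean P r -> new_avoid P (subtree r).
Proof. by move=> cl y n Py; rewrite inE (clean_cop cl Py). Qed.

(* There are more children than cops.                                         *)
Lemma clean_child P n : depth n < N -> exists2 r, is_child n r & clean P r.
Proof.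
move=> lt; suff /existsP[i cl] : [exists i, clean P (child n i)].
  by exists (child n i); first exact: is_child_child.
apply: contraT => /existsPn dirty.
have /fin_all_exists[cop copP] : forall i, exists z,
    exists2 m, anc (child n i) m & P z = Some m.
  move=> i; have /forall_inPn[m im /freePn[z Pz]] := dirty i.
  by exists z, m.
have cop_inj : injective cop.
  move=> i j ij; have [m im Pi] := copP i; have [m' jm Pj] := copP j.
  move: Pj; rewrite -ij Pi => -[mm']; rewrite -mm' {m' mm'} in jm.
  have di := depth_child (is_child_child i lt).
  have dj := depth_child (is_child_child j lt).
  apply: (child_inj lt); apply: anc_depth_eq; last by rewrite di dj.
  by apply: anc_comparable im jm _; rewrite di dj.
have := leq_card cop cop_inj; rewrite card_sum !card_ord.
by rewrite leqNgt pebbles_lt_arity.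
Qed.

Lemma escape_child P n r : is_child n r -> clean P r -> escape P n r.
Proof.
move=> nr cl; apply: escape1; first exact: tree_adj_child.
exact: clean_free cl (anc_refl r).
Qed.

Lemma walk_down P n e : depth n <= e <= N ->
  exists a, [/\ anc n a, depth a = e & escape P n a].
Proof.
move=> /andP[]; move ed: (e - depth n) => k.
elim: k n ed => [|k IH] n ed le le'.
  by exists n; rewrite anc_refl; split; [|lia|exact: connect0].
have [m nm clm] : exists2 m, is_child n m & clean P m.
  by apply: clean_child; lia.
have dm := depth_child nm; have /andP[ancnm _] := is_child_proper nm.
have [|||a [ma da esc]] := IH m; rewrite ?dm //; try lia.
exists a; split=> //; first exact: anc_trans ma.
exact: connect_trans (escape_child nm clm) esc.
Qed.

Lemma descend P z v n e : depth n < e <= N ->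
  exists r a, [/\ is_child n r, clean (land_cop P z v) r, anc r a, depth a = e &
    escape (lift_cop P z) n a].
Proof.
move=> /andP[lt le].
have [r nr cl] := clean_child (land_cop P z v) (leq_trans lt le).
have [|a [ra da esc]] := walk_down (lift_cop P z) (n := r) (e := e).
  by rewrite (depth_child nr) lt.
exists r, a; split=> //.
exact: connect_trans (escape_child nr (clean_lift cl)) esc.
Qed.

Lemma retreat P s rho : free P rho -> anc s rho ->
  exists rho', [/\ anc s rho', anc rho' rho, escape P rho rho' &
    forall n, anc s n -> near_anc reach n rho' -> ~~ free P n].
Proof.
move=> fr srho.
pose reachable n := [&& anc s n, anc n rho & escape P rho n].
have reach_rho : reachable rho.
  by rewrite /reachable srho anc_refl; apply: connect0.
case: (arg_minnP (@depth d N) reach_rho) => rho' /and3P[srho' rho'rho esc] low.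
exists rho'; split=> // n sn nrho'; apply/negP=> frn.
have /andP[ancn lt] := near_anc_proper nrho'.
suff /low : reachable n by rewrite leqNgt lt.
rewrite /reachable sn (anc_trans ancn rho'rho) /=.
by apply: connect_trans esc _; apply: escape1 frn; rewrite /tree_adj nrho' orbT.
Qed.

End Robber.

(** * Blocks of levels *)

Section Blocks.
Variables w l t : nat.
Local Notation k1 := w.+1.
Local Notation k2 := l.+1.
Hypothesis t_gt0 : 0 < t.

(* Chosen so that level [block_len - w] of a block is level [k1 * t + k1]:    *)
(* driving the robber there costs [t] uses of each reusable pair.             *)
Definition block_len := k1 * t + k1 + w.
Local Notation L := block_len.

Definition height := k2 * L.
Definition arity := (k1 + k2).+1.

(* [k1] cops can sweep the levels of reach [w], but the two levels around the *)
(* end of a block (depths count from 0) need one cop more.                    *)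
Definition reach (i : nat) : nat := if i.+1 %% L <= 1 then k1 else w.

Local Notation node := (node arity height).
Local Notation peb := (pebble k1 k2).
Local Notation near_anc := (@near_anc arity height reach).
Local Notation tree_adj := (@tree_adj arity height reach).
Local Notation escape := (escape tree_adj).
Local Notation can_dodge := (can_dodge tree_adj).
Implicit Types (P : copmap node k1 k2) (U : 'I_k1 -> nat) (p : seq peb).
Implicit Types (a m n r s v rho : node) (x : 'I_k1) (y : 'I_k2) (z : peb).

Lemma block_len_gt : k1 < L.
Proof. by rewrite /L; nia. Qed.

Lemma block_end_gt b i : i.+1 = b * L -> k1 <= i.
Proof. by have := block_len_gt; case: b => [|b]; rewrite ?mulSn; lia. Qed.

Lemma reach_ge i : w <= reach i.
Proof. by rewrite /reach; case: ifP. Qed.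

Lemma reach_block_end i b : i.+1 = b * L -> reach i = k1.
Proof. by rewrite /reach => ->; rewrite modnMl. Qed.

Lemma reach_block_start b : reach (b * L) = k1.
Proof. by rewrite /reach -addn1 modnMDl leq_mod. Qed.

(** * Spoiler's schedule *)

Definition reusable_rank (i : nat) : nat := count (predC (dvdn L)) (iota 1 i).

Definition schedule (i : nat) : peb :=
  if L %| i.+1 then inr (inord (i.+1 %/ L).-1)
  else inl (inord (reusable_rank i %% k1)).

Lemma reusable_rankS i : reusable_rank i.+1 = reusable_rank i + ~~ (L %| i.+1).
Proof.
rewrite /reusable_rank -[in LHS](addn1 i) iotaD count_cat /=.
by rewrite addn0 add1n.
Qed.

Lemma reusable_rank_mono i d :
  reusable_rank i <= reusable_rank (i + d) <= reusable_rank i + d.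
Proof.
rewrite /reusable_rank iotaD count_cat leq_addr leq_add2l.
by rewrite (leq_trans (count_size _ _)) // size_iota.
Qed.

Lemma reusable_schedule i : reusable (schedule i) = ~~ (L %| i.+1).
Proof. by rewrite /schedule; case: ifP. Qed.

Lemma schedule_once i j : i < j <= height -> ~~ reusable (schedule j) ->
  schedule i <> schedule j.
Proof.
move=> /andP[lt le]; rewrite reusable_schedule negbK => dj.
rewrite /schedule dj; case: ifP => // di [] /(congr1 val).
have Lg := block_len_gt; have L_gt0 : 0 < L by lia.
have [/dvdnP[b eb] /dvdnP[b' eb']] := (di, dj); rewrite eb eb' !mulnK //.
have b_gt0 : 0 < b by case: b eb.
have bb' : b < b' by rewrite -(ltn_pmul2r L_gt0) -eb -eb'; lia.
have b'k : b' <= k2.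
  rewrite -ltnS -(ltn_pmul2r L_gt0) -eb' mulSn.
  by move: le; rewrite /height; lia.
by rewrite /= !inordK; lia.
Qed.

Lemma reusable_rank_window i j j' : j < j' <= i -> i - j <= reach i ->
  ~~ (L %| j'.+1) -> reusable_rank j' < reusable_rank j + k1.
Proof.
move=> /andP[lt le] ler dj'; have [le_w|gt_w] := leqP (j' - j) w.
  by have := reusable_rank_mono j (j' - j); rewrite subnKC ?(ltnW lt) //; lia.
move: ler; rewrite /reach; case: ifP => [start ler|_]; last lia.
have {}start : L %| j'.
  have ij' : j' = i by lia.
  move: start dj'; rewrite -ij' modnS; case: ifP => //= _.
  by rewrite ltnS leqn0.
have rankE : reusable_rank j' = reusable_rank j'.-1.
  by rewrite -{1}(ltn_predK lt) reusable_rankS (ltn_predK lt) start addn0.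
by have := reusable_rank_mono j (j'.-1 - j); rewrite subnKC; lia.
Qed.

Lemma schedule_undisturbed i j : j < i <= height -> i - j <= reach i ->
  undisturbed schedule j i.+1.
Proof.
move=> /andP[_ le] ler j' /andP[lt]; rewrite ltnS => le' e.
have [new|] := boolP (reusable (schedule j')); last first.
  move=> new; apply: (schedule_once _ new (esym e)).
  by rewrite lt (leq_trans le').
have := new; rewrite e; move: new e; rewrite !reusable_schedule => dj' + dj.
have rank_lt : reusable_rank j < reusable_rank j'.
  have := reusable_rank_mono j.+1 (j' - j.+1); rewrite subnKC // => /andP[+ _].
  by apply: leq_trans; rewrite reusable_rankS dj addn1.
have rank_up : reusable_rank j' < reusable_rank j + k1.
  by apply: reusable_rank_window ler dj'; rewrite lt.
rewrite /schedule (negPf dj) (negPf dj') => -[] /(congr1 val).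
rewrite /= !inordK ?ltn_pmod // => /eqP.
by rewrite eqn_mod_dvd; [move=> /dvdn_leq; lia|lia].
Qed.

(** * The robber below the end of a block *)

Hypothesis t_w0 : w = 0 -> t = 1.

Lemma reach_gt0 i : 0 < reach i.
Proof.
rewrite /reach; case: ifP => // /negbT; case: (posnP w) => // w0.
have -> : L = 2 by rewrite /L w0 t_w0.
by rewrite -ltnNge; have := ltn_pmod i.+1 (isT : 0 < 2); lia.
Qed.

Lemma pebbles_lt_arity : k1 + k2 < arity.
Proof. exact: ltnSn. Qed.

Definition bag a : {set node} := lineage a k1.

(* A robber around [a] needs only one more block for each unused pair.        *)
Definition refuge P a b : Prop :=
  [/\ (depth a).+1 = b * L, b + unused P <= k2 & new_avoid P (bag a)].

Definition around a rho : bool := (rho \in bag a) || is_child a rho.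

Definition safe P rho : Prop := exists a b, refuge P a b /\ around a rho.

Lemma tree_adj_bag a n n' :
  n \in bag a -> n' \in bag a -> n != n' -> tree_adj n n'.
Proof.
wlog le : n n' / depth n <= depth n'.
  move=> sym nbag n'bag ne; have [le|/ltnW le] := leqP (depth n) (depth n').
    exact: sym.
  by rewrite tree_adj_sym; apply: sym => //; rewrite eq_sym.
rewrite !inE => /andP[na lt] /andP[n'a _] ne; apply/orP; left.
rewrite /near_anc proper_ancE (anc_comparable na n'a le) ne.
have := reach_ge (depth n'); have := anc_depth n'a; lia.
Qed.

Lemma near_anc_bag a b n r :
  (depth a).+1 = b * L -> n \in bag a -> is_child a r -> near_anc n r.
Proof.
move=> da; rewrite inE => /andP[na lt] ar.
rewrite /near_anc (proper_anc_child _ ar) na (depth_child ar) da.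
rewrite reach_block_start.
have := anc_depth na; lia.
Qed.

Lemma escape_to_bag P a b rho n : (depth a).+1 = b * L -> around a rho ->
  n \in bag a -> free P n -> escape P rho n.
Proof.
move=> da rhoa nbag frn; have [->|ne] := eqVneq rho n; first exact: connect0.
apply: escape1 => //; case/orP: rhoa => [rhobag|ar].
  exact: tree_adj_bag rhobag nbag ne.
by rewrite tree_adj_sym /tree_adj (near_anc_bag da nbag ar).
Qed.

Lemma safe_step_reusable P rho x v : safe P rho ->
  can_dodge P (inl x) v rho (safe (land_cop P (inl x) v)).
Proof.
move=> [a [b [[da le avoid] rhoa]]]; have Lg := block_len_gt.
have da_lt : depth a < height by rewrite /height da; apply: leq_mul; lia.
have [r ar cl] := clean_child pebbles_lt_arity (land_cop P (inl x) v) da_lt.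
have [|n nbag frn] := exists_free_lift x avoid.
  by rewrite card_lineage // ltnW // ltnS (block_end_gt da).
exists r; split; first exact: clean_neq cl (anc_refl r).
  apply: connect_trans (escape_to_bag da rhoa nbag frn) _; apply: escape1.
    by rewrite /tree_adj (near_anc_bag da nbag ar).
  exact: clean_free (clean_lift cl) (anc_refl r).
exists a, b; split; last by rewrite /around ar orbT.
by split; rewrite ?unused_land_reusable //; apply: new_avoid_land_reusable.
Qed.

Lemma safe_descend P y v rho b : P (inr y) = None ->
    depth rho + k1 < b.+1 * L -> b + unused P <= k2 ->
  can_dodge P (inr y) v rho (safe (land_cop P (inr y) v)).
Proof.
move=> Py lt le; have Lg := block_len_gt; have un := unused_land_new v Py.
have bL : b.+1 * L <= height by apply: leq_mul; lia.
have [|r [a [rhor cl ra da esc]]] :=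
    descend reach_gt0 pebbles_lt_arity P (inr y) v
            (n := rho) (e := (b.+1 * L).-1).
  by apply/andP; split; lia.
have dr := depth_child rhor.
exists a; split=> //; first exact: clean_neq cl ra.
exists a, b.+1; split; last by rewrite /around inE anc_refl subnn.
split; [by rewrite da; lia | by lia |].
by apply: new_avoid_subset (new_avoid_clean cl); apply: lineage_subtree; lia.
Qed.

Lemma safe_step_new P rho y v : safe P rho -> P (inr y) = None ->
  can_dodge P (inr y) v rho (safe (land_cop P (inr y) v)).
Proof.
move=> [a [b [[da le _] rhoa]]] Py; apply: safe_descend Py _ le.
have := block_len_gt; rewrite mulSn -da.
case/orP: rhoa => [|/depth_child ->]; last lia.
by rewrite inE => /andP[/anc_depth]; lia.
Qed.

(** * Driving the robber down a block *)

Definition charge x U : 'I_k1 -> nat := fun x' => (x' == x) + U x'.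

(* Spoiler drives the robber one level down only by moving the pair that      *)
(* stands [k1] levels above.                                                  *)
Definition paid P U s rho : Prop :=
  (forall x, (depth rho - depth s - w) %/ k1 <= U x) /\
  (forall x n, P (inl x) = Some n -> anc s n -> anc n rho ->
     (depth n - depth s).+1 %/ k1 <= U x).

Definition near_ancs s rho : {set node} := [set n | anc s n & near_anc n rho].

Definition block_top P s b : Prop :=
  [/\ depth s = b * L, b + unused P = k2 & new_avoid P (subtree s)].

Definition in_block P U rho : Prop :=
  exists s b, block_top P s b /\
    [/\ anc s rho, depth rho < depth s + L & paid P U s rho].

Lemma in_block_leq P U U' rho :
  (forall x, U x <= U' x) -> in_block P U rho -> in_block P U' rho.
Proof.
move=> UU' [s [b [top [srho lt [rho_paid cop_paid]]]]].
exists s, b; split=> //; split=> //; split=> [x|x n Px sn nrho].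
  exact: leq_trans (UU' x).
exact: leq_trans (cop_paid _ _ Px sn nrho) (UU' x).
Qed.

Lemma paid_anc P U s rho rho' :
  anc rho' rho -> paid P U s rho -> paid P U s rho'.
Proof.
move=> rho'rho [rho_paid cop_paid]; split=> [x|x n Px sn nrho'].
  by apply/(leq_trans _ (rho_paid x))/leq_div2r; have := anc_depth rho'rho; lia.
exact: cop_paid Px sn (anc_trans nrho' rho'rho).
Qed.

Lemma succ_div_le i : i.+1 %/ k1 <= ((i - w) %/ k1).+1.
Proof.
have [le|lt] := leqP w i; last by rewrite divn_small //; lia.
by rewrite -{1}(subnK le) -addnS divnDr ?dvdnn // divnn addn1.
Qed.

Lemma paid_land P U s rho x v :
  paid P U s rho -> paid (land_cop P (inl x) v) (charge x U) s rho.
Proof.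
move=> [rho_paid cop_paid]; split=> [x'|x' n].
  exact: leq_trans (rho_paid x') (leq_addl _ _).
rewrite ffunE (inj_eq (@inl_inj _ _)) /charge; case: eqP => [->|_] Pn sn nrho.
  apply: leq_trans (leq_trans (succ_div_le _) (rho_paid x : _ < _.+1)).
  by apply: leq_div2r; have := anc_depth nrho; lia.
exact: cop_paid Pn sn nrho.
Qed.

Lemma guarded_lineage P x s rho k :
    anc s rho -> depth s + k <= depth rho -> k <= reach (depth rho) ->
    guarded P x (near_ancs s rho) ->
  guarded P x (lineage rho k.+1 :\ rho).
Proof.
move=> srho le ler; apply: guarded_subset.
apply/subsetP=> n; rewrite !inE => /and3P[ne nrho lt].
rewrite /near_anc proper_ancE nrho ne (anc_comparable srho nrho); lia.
Qed.

Lemma paid_child P U s rho x v m :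
    anc s rho -> guarded P x (near_ancs s rho) ->
    is_child rho m -> clean (land_cop P (inl x) v) m ->
  paid P U s rho -> paid (land_cop P (inl x) v) (charge x U) s m.
Proof.
move=> srho guard rhom cl pd; have [rho_paid cop_paid] := pd.
have dm := depth_child rhom; have ds := anc_depth srho.
split=> [x'|x' n Pn sn]; last first.
  rewrite anc_eqVproper (proper_anc_child _ rhom) => /predU1P[nm|nrho].
    by have := clean_cop cl Pn; rewrite nm anc_refl.
  by have [_] := paid_land x v pd; apply.
rewrite dm /charge; case: eqVneq => [->|ne].
  apply: leq_trans (leq_trans (succ_div_le _) (rho_paid x : _ < _.+1)).
  by apply: leq_div2r; lia.
have [le|lt] := leqP (depth s + w) (depth rho); last by rewrite divn_small; lia.
have guard_w := guarded_lineage srho le (reach_ge _) guard.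
have [|n] := guarded_all guard_w _ ne.
  by rewrite card_proper_lineage //; lia.
rewrite !inE => /and3P[_ nrho lt] Px'.
have sn : anc s n by apply: anc_comparable srho nrho _; lia.
by apply: leq_trans (cop_paid _ _ Px' sn nrho); apply: leq_div2r; lia.
Qed.

Lemma guarded_not_block_end P x s rho b :
    depth s = b * L -> anc s rho -> guarded P x (near_ancs s rho) ->
  (depth rho).+1 <> depth s + L.
Proof.
move=> ds srho guard rho_end; have Lg := block_len_gt.
have reach_rho : reach (depth rho) = k1.
  by apply: (reach_block_end (b := b.+1)); rewrite mulSn; lia.
have guard_k1 : guarded P x (lineage rho k1.+1 :\ rho).
  by apply: guarded_lineage srho _ _ guard; rewrite ?reach_rho //; lia.
by have := card_guarded guard_k1; rewrite card_proper_lineage ?ltnn //; lia.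
Qed.

Lemma retreat_guarded P x s rho : new_avoid P (subtree s) -> free P rho ->
    anc s rho ->
  exists rho', [/\ anc s rho', anc rho' rho,
    escape (lift_cop P (inl x)) rho rho' & guarded P x (near_ancs s rho')].
Proof.
move=> avoid fr srho.
have fr_lift := free_lift (inl x) fr.
have [rho' [srho' rho'rho esc taken]] := retreat reach fr_lift srho.
exists rho'; split=> //; apply: guarded_lift => [|n].
  by apply: new_avoid_subset avoid; apply/subsetP=> n; rewrite !inE => /andP[].
by rewrite inE => /andP[sn nrho']; apply: taken.
Qed.

Lemma in_block_step_reusable P U rho x v :
    in_block P U rho -> free P rho -> 0 < unused P ->
  can_dodge P (inl x) v rho (in_block (land_cop P (inl x) v) (charge x U)).
Proof.
move=> [s [b [[ds bk avoid] [srho lt pd]]]] fr un.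
have [rho' [srho' rho'rho esc guard]] := retreat_guarded x avoid fr srho.
have {}pd := paid_anc rho'rho pd; have le := anc_depth rho'rho.
have top : block_top (land_cop P (inl x) v) s b.
  by split; rewrite ?unused_land_reusable //; apply: new_avoid_land_reusable.
have [ev|ne] := eqVneq rho' v; last first.
  exists rho'; split=> //; exists s, b; split=> //; split=> //; first by lia.
  exact: paid_land.
have lt' : (depth rho').+1 < depth s + L.
  by have := guarded_not_block_end ds srho' guard; lia.
have rho'_lt : depth rho' < height.
  apply: ltnW; apply: leq_trans lt' _.
  by rewrite ds addnC -mulSn; apply: leq_mul; lia.
have [m rho'm cl] :=
  clean_child pebbles_lt_arity (land_cop P (inl x) v) rho'_lt.
exists m; split; first exact: clean_neq cl (anc_refl m).
  exact: connect_trans esc (escape_child reach_gt0 rho'm (clean_lift cl)).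
exists s, b; split=> //; split; last exact: paid_child pd.
  by have /andP[? _] := is_child_proper rho'm; apply: anc_trans srho' _.
by rewrite (depth_child rho'm).
Qed.

Lemma in_block_step_new P U rho y v :
    in_block P U rho -> P (inr y) = None ->
  can_dodge P (inr y) v rho (fun rho' => let P' := land_cop P (inr y) v in
    safe P' rho' \/ (forall x, t <= U x) /\ in_block P' (fun=> 0) rho').
Proof.
move=> [s [b [[ds bk _] [_ lt [rho_paid _]]]]] Py.
have un := unused_land_new v Py; have Lg := block_len_gt.
have [low|high] := ltnP (depth rho + k1) (b.+1 * L).
  have bk_le : b + unused P <= k2 by rewrite bk.
  by apply: can_dodge_imply (safe_descend v Py low bk_le) => rho'; left.
have [|r [a [rhor cl ra da esc]]] :=
    descend reach_gt0 pebbles_lt_arity P (inr y) v (n := rho) (e := b.+1 * L).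
  by rewrite mulSn addnC -ds lt /= ds -mulSnr; apply: leq_mul; lia.
have cla := clean_anc cl ra.
exists a; split=> //; first exact: clean_neq cl ra.
right; split=> [x|].
  apply: leq_trans (rho_paid x); rewrite -[t](mulKn _ (ltn0Sn w)).
  apply: leq_div2r.
  by move: high; rewrite mulSn -ds /block_len; lia.
exists a, b.+1; split; first by split; [|lia|exact: new_avoid_clean].
split; [exact: anc_refl|lia|split=> [x|x n Px an _]].
  by rewrite subnn div0n.
by have := clean_cop cla Px; rewrite an.
Qed.

(** * Duplicator's play *)

Definition robber_inv p P rho : Prop :=
  safe P rho \/
  [/\ reuses_before t p, 0 < unused P &
      in_block P (fun x => recent_uses (inl x) p) rho].

Lemma robber_inv_start : robber_inv [::] [ffun=> None] (root _ _).
Proof.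
have un : unused ([ffun=> None] : copmap node k1 k2) = k2.
  rewrite /unused -[RHS]card_ord -cardsT.
  by apply: eq_card => y; rewrite !inE ffunE.
right; split; [by case | by rewrite un |].
exists (root _ _), 0; split; first by split=> [|//|y n]; rewrite ?un ?ffunE.
split; [exact: anc_refl | by have := block_len_gt; rewrite /depth /=; lia |].
by split=> [x|x n]; rewrite ?ffunE // subnn div0n.
Qed.

Lemma robber_inv_reusable p P rho x v : robber_inv p P rho -> free P rho ->
  can_dodge P (inl x) v rho
    (robber_inv (rcons p (inl x)) (land_cop P (inl x) v)).
Proof.
move=> [sf|[rb un blk]] fr.
  by apply: can_dodge_imply (safe_step_reusable x v sf) => rho'; left.
apply: can_dodge_imply (in_block_step_reusable x v blk fr un) => rho' blk'.
right; split; rewrite ?unused_land_reusable //.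
  exact: reuses_before_rcons.
by apply: in_block_leq blk' => x'; rewrite recent_uses_rcons /= eq_sym.
Qed.

Lemma robber_inv_new p P rho y v : (forall z, isSome (P z) = (z \in p)) ->
    robber_inv p P rho -> inr y \notin p ->
  can_dodge P (inr y) v rho (fun rho' =>
    robber_inv (rcons p (inr y)) (land_cop P (inr y) v) rho' \/
    reuses_before_new t (rcons p (inr y))).
Proof.
move=> placed inv; rewrite -placed; case Py: (P (inr y)) => // _.
case: inv => [sf|[rb _ blk]].
  by apply: can_dodge_imply (safe_step_new v sf Py) => rho'; left; left.
apply: can_dodge_imply (in_block_step_new v blk Py) => rho' [sf|[le blk']].
  by left; left.
have rb' : reuses_before t (rcons p (inr y)) by apply: reuses_before_rcons.
have [un0|un] := posnP (unused (land_cop P (inr y) v)); [right|left; right].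
  split=> // y'; move/eqP: un0; rewrite cards_eq0 => /eqP/setP/(_ y').
  rewrite !inE ffunE mem_rcons inE -placed.
  by case: eqP => //= _; case: (P (inr y')).
by split=> //; apply: in_block_leq blk'.
Qed.

Theorem robber_reuses (s : strategy k1 k2 (tree_cfi arity height reach false)
                                   (tree_cfi arity height reach true)) :
    winning s ->
  exists fs, complete_play s fs /\ reuses_before_new t (used (play s fs)).
Proof.
move=> win; apply: (play_of_robber win robber_inv_start).
  exact: reuses_before_new_rcons.
move=> p P rho [x|y] v placed inv fr av; last first.
  exact: robber_inv_new placed inv av.
by apply: can_dodge_imply (robber_inv_reusable x v inv fr) => rho'; left.
Qed.

End Blocks.

Theorem theorem18 (k1 k2 r : nat) (hk1 : 1 <= k1) (hk2 : 1 <= k2)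
    (hr : 1 <= r) :
  exists G H : cgraph,
    (exists s : strategy k1 k2 G H, winning s) /\
    (forall s : strategy k1 k2 G H, winning s ->
       exists fs : seq (bijection G H),
         complete_play s fs /\
         reuses_before_new (if k1 == 1 then 1 else r)
           [seq rd_pebble rd | rd <- play s fs]).
Proof.
case: k1 hk1 => // w _; case: k2 hk2 => // l _.
set t := if _ then _ else _.
have t_gt0 : 0 < t by rewrite /t; case: ifP.
have t_w0 : w = 0 -> t = 1 by rewrite /t => ->.
pose base := tree_cfi (arity w l) (height w l t) (reach w t).
exists (base false), (base true); split.
  by apply: sweep_wins; [apply: schedule_once|apply: schedule_undisturbed].
by move=> s /(robber_reuses t_gt0 t_w0).
Qed.
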